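(* Let $\Phi\in\mathcal{E}(I)$, let $f:I\to\mathbb{R}$ be a $\Phi$-convex function and let $\varphi:I\to\mathbb{R}$ be a $\Phi$-slope function for $f$. Then $\varphi$ is $\Phi^*$-monotone, where $\Phi^*:[0,\ell(I))\to[0,\infty)$ is defined by $$\Phi^*(t):=\begin{cases}2\dfrac{\Phi(t)}{t} & \text{if } 0<t<\ell(I),\\ 0 & \text{if } t=0.\end{cases}$$
   Context: $I\subseteq\mathbb{R}$ is a nonempty open interval and $\ell(I)\in(0,\infty]$ is its length. $\mathcal{E}(I)$ is the set of all functions $\Phi:[0,\ell(I))\to[0,\infty)$ (called error functions). For $\Phi\in\mathcal{E}(I)$, a function $f:I\to\mathbb{R}$ is called $\Phi$-convex if for all $x,y\in I$ and $t\in[0,1]$, $$f(tx+(1-t)y)\leq tf(x)+(1-t)f(y)+t\Phi((1-t)|x-y|)+(1-t)\Phi(t|x-y|).$$ A function $\varphi:I\to\mathbb{R}$ is a $\Phi$-slope function for $f$ if $f(u)+(x-u)\varphi(u)\leq f(x)+\Phi(|u-x|)$ for all $x,u\in I$. For $\Psi\in\mathcal{E}(I)$, a function $g:I\to\mathbb{R}$ is $\Psi$-monotone if $g(x)\leq g(y)+\Psi(y-x)$ for all $x,y\in I$ with $x\leq y$. *)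

(* Defs.v *)
From HB Require Import structures.
From mathcomp Require Import all_boot all_order all_algebra.
From mathcomp Require Import classical_sets reals ereal topology normedtype.

Set Implicit Arguments.
Unset Strict Implicit.
Unset Printing Implicit Defensive.

Import Order.TTheory GRing.Theory Num.Theory.
Import numFieldNormedType.Exports.

Local Open Scope classical_set_scope.
Local Open Scope ring_scope.

(* Functions on I, and on [0, ell(I)[, are represented by total functions
   R -> R that are only ever constrained and used on those sets. *)

Definition ell (R : realType) (I : set R) : \bar R :=
  (ereal_sup (EFin @` I) - ereal_inf (EFin @` I))%E.

(* The set E(I). *)
Record error_function (R : realType) (I : set R) := ErrorFunction {
  error_fun :> R -> R;
  error_fun_ge0 : forall t : R, 0 <= t -> (t%:E < ell I)%E -> 0 <= error_fun t
}.

Definition Phi_convex (R : realType) (I : set R) (Phi : error_function I)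
    (f : R -> R) : Prop :=
  forall x y t : R, I x -> I y -> 0 <= t <= 1 ->
    f (t * x + (1 - t) * y) <=
      t * f x + (1 - t) * f y
      + t * Phi ((1 - t) * `|x - y|) + (1 - t) * Phi (t * `|x - y|).

Definition slope_function (R : realType) (I : set R) (Phi : error_function I)
    (f phi : R -> R) : Prop :=
  forall x u : R, I x -> I u ->
    f u + (x - u) * phi u <= f x + Phi `|u - x|.

Definition Psi_monotone (R : realType) (I : set R) (Psi : error_function I)
    (g : R -> R) : Prop :=
  forall x y : R, I x -> I y -> x <= y -> g x <= g y + Psi (y - x).

Definition star_fun (R : realType) (Phi : R -> R) (t : R) : R :=
  if t == 0 then 0 else 2 * (Phi t / t).

Lemma star_fun_ge0 (R : realType) (I : set R) (Phi : error_function I) (t : R) :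
  0 <= t -> (t%:E < ell I)%E -> 0 <= star_fun Phi t.
Proof.
move=> t0 tI; rewrite /star_fun; case: ifP => // _.
by rewrite mulr_ge0// divr_ge0// error_fun_ge0.
Qed.

Definition Phi_star (R : realType) (I : set R) (Phi : error_function I) :
    error_function I :=
  ErrorFunction (@star_fun_ge0 R I Phi).

(* Main.v *)
Require Import Defs.
From mathcomp Require Import all_boot all_order all_algebra.
From mathcomp Require Import classical_sets reals ereal topology normedtype.
From mathcomp Require Import lra.

Import Order.TTheory GRing.Theory Num.Theory.
Import numFieldNormedType.Exports.

Local Open Scope classical_set_scope.
Local Open Scope ring_scope.

(** For [x < y] the slope inequality is used twice: the support line at [x] is
    evaluated at [y], and the support line at [y] is evaluated at [x]. Both
    errors are [Phi (y - x)], so on adding the two inequalities the values of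
    [f] cancel, leaving [(y - x) * (phi x - phi y) <= 2 * Phi (y - x)]; dividing
    by [y - x] gives the bound. *)

Theorem proposition3p3 (R : realType) (I : set R)
  (I_open : open I) (I_interval : is_interval I) (I_nonempty : I !=set0)
  (Phi : error_function I) (f : R -> R) (f_convex : Phi_convex Phi f)
  (phi : R -> R) (phi_slope : slope_function Phi f phi) :
  Psi_monotone (Phi_star Phi) phi.
Proof.
move=> x y Ix Iy; rewrite le_eqVlt => /predU1P[<-|xy].
  by rewrite /= /star_fun subrr eqxx addr0.
have d_gt0 : 0 < y - x by rewrite subr_gt0.
rewrite /= /star_fun gt_eqF// mulrA -lerBlDl ler_pdivlMr//.
have := phi_slope _ _ Iy Ix; have := phi_slope _ _ Ix Iy.
rewrite (distrC x y) gtr0_norm// => slope_y slope_x.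
have := lerD slope_x slope_y; nra.
Qed.
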